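(* Let $\Gamma=(V,H)$ be an oriented hypergraph in which no vertex has degree zero, and let $\lambda_1$ and $\lambda_n$ be the smallest and largest eigenvalues of the normalized Laplacian $\Delta_2$, i.e. $\lambda_1=\min_{f\ne0}\mathrm{RQ}_2(f)$ and $\lambda_n=\max_{f\ne0}\mathrm{RQ}_2(f)$. Let $1\le l<k$ be integers. For any $(k,l)$-family $(S_1,\ldots,S_k)$ with $S_1\cup\cdots\cup S_k\ne\emptyset$, $$\lambda_1\le\frac{k\,(e(S_1)+\cdots+e(S_k))-l^2\,e(S_1\cup\cdots\cup S_k)}{(k-l)\,l\,\mathrm{vol}(S_1\cup\cdots\cup S_k)}\le\lambda_n.$$
   Context: An oriented hypergraph $\Gamma=(V,H)$ consists of a finite vertex set $V$ and a finite set $H$ of hyperedges, each a pair $(h_{in},h_{out})$ of disjoint subsets of $V$ with nonempty union. $\deg(i)$ = number of hyperedges $h$ with $i\in h_{in}\cup h_{out}$ (assumed $\ge1$); $\mathrm{vol}(S)=\sum_{i\in S}\deg(i)$. For $S\subseteq V$, $e(S)=\sum_{h\in H}(\#(S\cap h_{in})-\#(S\cap h_{out}))^2$. $\mathrm{RQ}_2(f)=\frac{\sum_{h\in H}(\sum_{i\in h_{in}}f(i)-\sum_{j\in h_{out}}f(j))^2}{\sum_{i\in V}\deg(i)f(i)^2}$. A $k$-tuple $(S_1,\ldots,S_k)$ of subsets of $V$ is a $(k,l)$-family if every vertex of $S_1\cup\cdots\cup S_k$ lies in exactly $l$ of the sets $S_r$. *)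

(* Defs.v *)
From HB Require Import structures.
From mathcomp Require Import all_boot all_order all_algebra.
From mathcomp Require Import classical_sets reals.

Set Implicit Arguments.
Unset Strict Implicit.
Unset Printing Implicit Defensive.

Import Order.TTheory GRing.Theory Num.Theory.
Local Open Scope ring_scope.

(* A hyperedge h = (h_in, h_out) is encoded as a pair: h.1 = h_in and
   h.2 = h_out. *)
Record oriented_hypergraph (V : finType) := OrientedHypergraph {
  hyperedges : {set {set V} * {set V}};
  hyperedge_disjoint : forall h, h \in hyperedges -> [disjoint h.1 & h.2];
  hyperedge_neq0 : forall h, h \in hyperedges -> h.1 :|: h.2 != finset.set0
}.

Section OrientedHypergraph.
Variables (V : finType) (G : oriented_hypergraph V).

Definition deg (i : V) : nat :=
  #|[set h in hyperedges G | i \in h.1 :|: h.2]|.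

Definition vol (S : {set V}) : nat := (\sum_(i in S) deg i)%N.

Section Real.
Variable R : realType.
Implicit Types (S : {set V}) (f : {ffun V -> R}).

Definition e S : R :=
  \sum_(h in hyperedges G) (#|S :&: h.1|%:R - #|S :&: h.2|%:R) ^+ 2.

Definition boundary f (h : {set V} * {set V}) : R :=
  \sum_(i in h.1) f i - \sum_(j in h.2) f j.

(* The normalized Laplacian Delta_2. Its i-th value is 1 / deg i times the sum,
   over the hyperedges h containing i, of the values of f on the vertices of h
   lying on the same side as i minus those on the side opposite to i. *)
Definition laplacian2 f : {ffun V -> R} :=
  [ffun i => (\sum_(h in hyperedges G | i \in h.1) boundary f h
              - \sum_(h in hyperedges G | i \in h.2) boundary f h)
             / (deg i)%:R].

Definition laplacian2_eigenvalue (a : R) : Prop :=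
  exists2 f, f != 0 & forall i, laplacian2 f i = a * f i.

Definition RQ2 f : R :=
  (\sum_(h in hyperedges G) boundary f h ^+ 2)
    / (\sum_i (deg i)%:R * f i ^+ 2).

Definition RQ2_value (a : R) : Prop := exists2 f, f != 0 & RQ2 f = a.

End Real.
End OrientedHypergraph.

Definition is_min (R : realType) (A : set R) (m : R) : Prop :=
  A m /\ lbound A m.

Definition is_max (R : realType) (A : set R) (m : R) : Prop :=
  A m /\ ubound A m.

Definition kl_family (V : finType) (k l : nat) (S : 'I_k -> {set V}) : Prop :=
  forall i, i \in \bigcup_(r < k) S r -> #|[set r | i \in S r]| = l.

(* Main.v *)
Require Import Defs.
From mathcomp Require Import all_boot all_order all_algebra.
From mathcomp Require Import classical_sets reals.
From mathcomp Require Import boolp topology normedtype derive.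
From mathcomp Require Import ring lra.

Set Implicit Arguments.
Unset Strict Implicit.
Unset Printing Implicit Defensive.

Import Order.TTheory GRing.Theory Num.Theory.
Import numFieldNormedType.Exports.
Local Open Scope ring_scope.

(** The minimum of a Rayleigh quotient is attained by compactness of the unit
    sphere; subtracting it from the energy leaves a positive semidefinite form
    vanishing at the minimiser, which therefore lies in the kernel of that form,
    i.e. is an eigenvector.  Applied to the energy and to its opposite, this
    gives lambda_1 N(f) <= E(f) <= lambda_n N(f) for every f, where E is the
    numerator and N the denominator of RQ_2.  The bounds on the (k,l)-family
    follow by summing these over the k test functions f_r = k 1_{S_r} - l 1_U:
    the energies add up to k (k sum_r e(S_r) - l^2 e(U)) and the denominators
    to k l (k - l) vol(U). *)

(** * Weighted Rayleigh quotients of symmetric forms *)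

Section QuadraticForms.
Variables (R : realType) (V : finType).
Implicit Types (A : V -> V -> R) (w f g : V -> R).

Definition bilform A f g : R := \sum_i f i * \sum_j A i j * g j.

Definition wnorm2 w f : R := \sum_i w i * f i ^+ 2.

Lemma bilform_sym A f g : (forall i j, A i j = A j i) ->
  bilform A f g = bilform A g f.
Proof.
move=> Asym; rewrite /bilform.
under eq_bigr do rewrite mulr_sumr.
rewrite exchange_big /=; apply: eq_bigr => i _; rewrite mulr_sumr.
by apply: eq_bigr => j _; rewrite Asym; ring.
Qed.

Lemma bilform_line A f g t : (forall i j, A i j = A j i) ->
  bilform A (fun i => f i + t * g i) (fun i => f i + t * g i) =
  bilform A f f + t *+ 2 * bilform A g f + t ^+ 2 * bilform A g g.
Proof.
move=> Asym.
have -> : t *+ 2 * bilform A g f = t * bilform A g f + t * bilform A f g.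
  by rewrite (bilform_sym f g Asym); ring.
rewrite /bilform !mulr_sumr -!big_split /=; apply: eq_bigr => i _.
have -> : \sum_j A i j * (f j + t * g j)
        = \sum_j A i j * f j + t * \sum_j A i j * g j.
  by rewrite mulr_sumr -big_split /=; apply: eq_bigr => j _; ring.
by ring.
Qed.

Lemma bilformZ A f t :
  bilform A (fun i => t * f i) (fun i => t * f i) = t ^+ 2 * bilform A f f.
Proof.
rewrite /bilform mulr_sumr; apply: eq_bigr => i _.
have -> : \sum_j A i j * (t * f j) = t * \sum_j A i j * f j.
  by rewrite mulr_sumr; apply: eq_bigr => j _; ring.
by ring.
Qed.

Lemma wnorm2Z w f t : wnorm2 w (fun i => t * f i) = t ^+ 2 * wnorm2 w f.
Proof. by rewrite /wnorm2 mulr_sumr; apply: eq_bigr => i _; ring. Qed.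

Lemma ffun_neq0 (f : {ffun V -> R}) : f != 0 -> exists i, f i != 0.
Proof.
move=> f_neq0; apply/existsP; apply: contraNT f_neq0 => /existsPn f0.
by apply/eqP/ffunP => i; rewrite ffunE; apply/eqP; rewrite -[_ == _]negbK f0.
Qed.

Lemma wnorm2_ge0 w f : (forall i, 0 < w i) -> 0 <= wnorm2 w f.
Proof.
by move=> w_gt0; apply: sumr_ge0 => i _; rewrite mulr_ge0 ?sqr_ge0 ?ltW.
Qed.

Lemma wnorm2_gt0 w (f : {ffun V -> R}) : (forall i, 0 < w i) -> f != 0 ->
  0 < wnorm2 w f.
Proof.
move=> w_gt0 f_neq0.
have [i fi_neq0] := ffun_neq0 f_neq0.
rewrite /wnorm2 (bigD1 i) //= ltr_pwDl //.
  by rewrite mulr_gt0 // exprn_even_gt0.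
by apply: sumr_ge0 => j _; rewrite mulr_ge0 ?sqr_ge0 ?ltW.
Qed.

(** Moving from [f] by [t] times [g = A f] changes the form by [2 t |g|^2 + O(t^2)]; a small
    negative [t] would make it negative unless [g = 0]. *)
Lemma psd_isotropic_kernel A f : (forall i j, A i j = A j i) ->
  (forall g, 0 <= bilform A g g) -> bilform A f f = 0 ->
  forall i, \sum_j A i j * f j = 0.
Proof.
move=> Asym psd f0 i0.
pose g i := \sum_j A i j * f j; pose q := bilform A g g.
have gfE : bilform A g f = \sum_i g i ^+ 2 by [].
have s_ge0 : 0 <= bilform A g f.
  by rewrite gfE sumr_ge0 // => i _; rewrite sqr_ge0.
have q_ge0 : 0 <= q by exact: psd.
have s0 : bilform A g f = 0.
  (* The optimal step is [- s / q] with [s = bilform A g f]; replacing [q] by [q + 1] keeps the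
     denominator positive when [q = 0], and the value stays negative for nonzero [s]. *)
  have := psd (fun i => f i + - (bilform A g f / (q + 1)) * g i).
  rewrite bilform_line // f0 add0r -/q; move: s_ge0.
  move: (bilform A g f) => s s_ge0.
  have -> : - (s / (q + 1)) *+ 2 * s + (- (s / (q + 1))) ^+ 2 * q
          = - (s ^+ 2 * (q + 2) / (q + 1) ^+ 2).
    by field; rewrite gt_eqF //; lra.
  rewrite oppr_ge0 pmulr_lle0; last by rewrite invr_gt0 exprn_gt0 //; lra.
  rewrite pmulr_lle0; last by lra.
  by move=> s2; apply/eqP; rewrite -sqrf_eq0 eq_le s2 sqr_ge0.
have /eqP := s0; rewrite gfE psumr_eq0; last by move=> i _; rewrite sqr_ge0.
move=> /allP /(_ i0 (mem_index_enum i0)) /=.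
by rewrite sqrf_eq0 => /eqP.
Qed.

Lemma continuous_sum (T : topologicalType) (I : Type) (s : seq I)
    (F : I -> T -> R) :
  (forall i, continuous (F i)) -> continuous (fun x => \sum_(i <- s) F i x).
Proof.
move=> cF x; elim: s => [|i s IHs].
  by under eq_fun do rewrite big_nil; exact: cvg_cst.
under eq_fun do rewrite big_cons.
by apply: cvgD => //; exact: cF.
Qed.

Lemma continuous_mul (T : topologicalType) (f g : T -> R) :
  continuous f -> continuous g -> continuous (fun x => f x * g x).
Proof. by move=> cf cg x; apply: cvgM; [exact: cf | exact: cg]. Qed.

(** The quotient is continuous on a compact sphere and invariant under scaling. The bound is stated
    without dividing by [wnorm2 w g], so it also covers [g = 0]. The vertex [v0] makes the sphere
    nonempty. *)
Lemma rayleigh_min_attained A w (v0 : V) : (forall i, 0 < w i) ->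
  exists2 f : {ffun V -> R}, f != 0 &
    forall g, bilform A f f / wnorm2 w f * wnorm2 w g <= bilform A g g.
Proof.
move=> w_gt0.
(* Functions on [V] are read as row vectors, whose bounded closed sets are compact. *)
pose F (x : 'rV[R]_#|V|) : {ffun V -> R} := [ffun i => x ord0 (enum_rank i)].
have F_neq0 x : x != 0 -> F x != 0.
  apply: contra => /eqP Fx0; apply/eqP/rowP => j.
  by have /ffunP /(_ (enum_val j)) := Fx0; rewrite !ffunE enum_valK mxE.
have contF i : continuous (fun x => F x i).
  move=> x; rewrite /F; under eq_fun do rewrite ffunE.
  exact: coord_continuous.
have contQ : continuous (fun x => bilform A (F x) (F x)).
  apply: continuous_sum => i; apply: continuous_mul; first exact: contF.
  apply: continuous_sum => j; apply: continuous_mul; last exact: contF.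
  exact: cst_continuous.
have contN : continuous (fun x => wnorm2 w (F x)).
  apply: continuous_sum => i; apply: continuous_mul.
    exact: cst_continuous.
  by under eq_fun do rewrite expr2; apply: continuous_mul; exact: contF.
pose sphere := [set x : 'rV[R]_#|V| | `|x| = 1]%classic.
have sphere_neq0 x : sphere x -> x != 0.
  by move=> /= x1; rewrite -normr_eq0 x1 oner_eq0.
pose rq x := bilform A (F x) (F x) / wnorm2 w (F x).
have normalize (x : 'rV[R]_#|V|) : x != 0 -> sphere (`|x|^-1 *: x).
  move=> x_neq0; rewrite /sphere /= normrZ normfV normr_id mulVf //.
  by rewrite normr_eq0.
have sphere_inh : (sphere !=set0)%classic.
  exists (`|const_mx 1 : 'rV[R]_#|V| |^-1 *: const_mx 1); apply: normalize.
  apply/eqP => /rowP /(_ (enum_rank v0)) /eqP.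
  by rewrite !mxE oner_eq0.
have sphere_compact : compact sphere.
  apply: bounded_closed_compact.
    by exists 1; split => // M M_gt1 x /= ->; exact: ltW.
  have /continuous_closedP norm_closed :=
    @norm_continuous _ ('rV[R]_#|V| : normedModType R).
  exact: norm_closed _ (@closed_eq _ (1 : R)).
have contrq : ({within sphere, continuous rq})%classic.
  apply: continuous_in_subspaceT => x /set_mem sx.
  apply: (@continuousM _ _ (fun y => bilform A (F y) (F y))
    (fun y => (wnorm2 w (F y))^-1)); first exact: contQ.
  apply: continuousV; last exact: contN.
  by rewrite gt_eqF ?wnorm2_gt0 ?F_neq0 ?sphere_neq0.
have [x sx minx] := compact_EVT_min sphere_inh sphere_compact contrq.
have x_neq0 : x != 0 by apply: sphere_neq0; exact: set_mem.
exists (F x); first exact: F_neq0.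
move=> g; rewrite -/(rq x).
pose y : 'rV[R]_#|V| := \row_j g (enum_val j).
have [y0|y_neq0] := eqVneq y 0.
  have g0 i : g i = 0.
    by have /rowP /(_ (enum_rank i)) := y0; rewrite !mxE enum_rankK.
  rewrite /wnorm2 /bilform !big1 ?mulr0 // => i _; rewrite g0 ?mul0r //.
  by rewrite expr0n mulr0.
have y_gt0 : 0 < `|y| by rewrite normr_gt0.
(* Both sides of the goal are homogeneous of degree 2, so the factor [|y|^2] cancels and only a
   point of the sphere remains. *)
have gE : g = fun i => `|y| * F (`|y|^-1 *: y) i.
  by apply/funext => i; rewrite ffunE !mxE enum_rankK mulVKf // gt_eqF.
rewrite gE bilformZ wnorm2Z mulrCA ler_pM2l ?exprn_gt0 //.
have := minx _ (mem_set (normalize _ y_neq0)).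
rewrite [rq (_ *: _)]/rq ler_pdivlMr // wnorm2_gt0 // F_neq0 // sphere_neq0 //.
exact: normalize.
Qed.

Lemma rayleigh_min_eigen A w (v0 : V) :
  (forall i j, A i j = A j i) -> (forall i, 0 < w i) ->
  exists c, (forall g, c * wnorm2 w g <= bilform A g g) /\
    exists2 f : {ffun V -> R}, f != 0 &
      forall i, \sum_j A i j * f j = c * (w i * f i).
Proof.
move=> Asym w_gt0; have [f f_neq0 minf] := rayleigh_min_attained A v0 w_gt0.
set c := _ / _ in minf; exists c; split => //; exists f => //.
(* With [c] the minimal quotient, [B = A - c diag(w)] is positive semidefinite and isotropic at [f];
   its kernel equation is the claim. *)
pose B i j := A i j - c * (w i * (i == j)%:R).
have BE i g : \sum_j B i j * g j = \sum_j A i j * g j - c * (w i * g i).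
  rewrite (bigD1 i) //= [in RHS](bigD1 i) //= /B eqxx /=.
  under eq_bigr => j ji do rewrite eq_sym (negPf ji) mulr0 mulr0 subr0.
  by ring.
have formE g : bilform B g g = bilform A g g - c * wnorm2 w g.
  rewrite /bilform /wnorm2 mulr_sumr -sumrB; apply: eq_bigr => i _.
  by rewrite BE; ring.
move=> i; apply/eqP; rewrite -subr_eq0 -BE; apply/eqP.
apply: psd_isotropic_kernel.
- move=> j k; rewrite /B Asym eq_sym; case: eqP => [->//|_].
  by rewrite !mulr0.
- by move=> g; rewrite formE subr_ge0.
- by rewrite formE /c divfK ?subrr // gt_eqF // wnorm2_gt0.
Qed.

End QuadraticForms.

(** * The hypergraph Laplacian as a symmetric form *)

Section Laplacian.
Variables (R : realType) (V : finType) (G : oriented_hypergraph V).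
Hypothesis deg_gt0 : forall i : V, (0 < deg G i)%N.
Implicit Types (f : {ffun V -> R}) (h : {set V} * {set V}).

Definition incidence h (i : V) : R := (i \in h.1)%:R - (i \in h.2)%:R.

(** The unnormalized Laplacian: the signed incidence matrix times its transpose. It is symmetric,
    whereas [laplacian2] divides its rows by the degrees. *)
Definition lap_coef (i j : V) : R :=
  \sum_(h in hyperedges G) incidence h i * incidence h j.

Definition energy f : R := \sum_(h in hyperedges G) boundary f h ^+ 2.

Definition degw (i : V) : R := (deg G i)%:R.

Lemma degw_gt0 i : 0 < degw i.
Proof. by rewrite ltr0n. Qed.

Lemma lap_coef_sym i j : lap_coef i j = lap_coef j i.
Proof. by apply: eq_bigr => h _; rewrite mulrC. Qed.

Lemma boundaryE f h : boundary f h = \sum_i incidence h i * f i.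
Proof.
rewrite /boundary big_mkcond [X in _ - X]big_mkcond -sumrB.
by apply: eq_bigr => i _; rewrite /incidence; do 2!case: ifP => _ /=; ring.
Qed.

Lemma lap_coef_sum f i :
  \sum_j lap_coef i j * f j =
  \sum_(h in hyperedges G) incidence h i * boundary f h.
Proof.
under eq_bigr do rewrite mulr_suml.
rewrite exchange_big /=; apply: eq_bigr => h _.
by rewrite boundaryE mulr_sumr; apply: eq_bigr => j _; rewrite mulrA.
Qed.

Lemma energyE f : energy f = bilform lap_coef f f.
Proof.
rewrite /bilform; under eq_bigr do rewrite lap_coef_sum mulr_sumr.
rewrite exchange_big /=; apply: eq_bigr => h _.
rewrite expr2 {1}boundaryE mulr_suml; apply: eq_bigr => i _; ring.
Qed.

Lemma laplacian2E f i :
  laplacian2 G f i = (\sum_j lap_coef i j * f j) / degw i.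
Proof.
rewrite ffunE lap_coef_sum; congr (_ / _).
rewrite big_mkcondr [X in _ - X]big_mkcondr -sumrB.
by apply: eq_bigr => h _; rewrite /incidence; do 2!case: ifP => _ /=; ring.
Qed.

Lemma RQ2E f : RQ2 G f = energy f / wnorm2 degw f.
Proof. by []. Qed.

Lemma laplacian2_eigenP f a :
  (forall i, laplacian2 G f i = a * f i) <->
  (forall i, \sum_j lap_coef i j * f j = a * (degw i * f i)).
Proof.
split=> fa i; have d_neq0 : degw i != 0 by rewrite gt_eqF ?degw_gt0.
  have /eqP := fa i; rewrite laplacian2E (can2_eq (divfK _) (mulfK _)) //.
  by move=> /eqP ->; ring.
by rewrite laplacian2E fa; field.
Qed.

(** Pairing the eigenvalue equation with the eigenfunction [f] gives
    [energy f = a * wnorm2 degw f]. *)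
Lemma laplacian2_eigenvalue_RQ2_value (a : R) :
  laplacian2_eigenvalue G a -> RQ2_value G a.
Proof.
move=> [f f_neq0 /laplacian2_eigenP fa]; exists f => //.
rewrite RQ2E energyE; apply: (canLR (mulfK _)).
  by rewrite gt_eqF ?wnorm2_gt0 //; exact: degw_gt0.
rewrite /bilform /wnorm2 mulr_sumr; apply: eq_bigr => i _.
by rewrite fa; ring.
Qed.

(** The minimum [c] of the quotient is itself an eigenvalue, hence [a <= c]. *)
Lemma min_eigenvalue_le_energy (a : R) :
  is_min (@laplacian2_eigenvalue V G R) a ->
  forall f, a * wnorm2 degw f <= energy f.
Proof.
move=> [[f0 f0_neq0 _] amin] f.
(* The existence of an eigenfunction forces [V] to be nonempty. *)
have [v0 _] := ffun_neq0 f0_neq0.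
have [c [cmin [g g_neq0 gc]]] := rayleigh_min_eigen v0 lap_coef_sym degw_gt0.
have ac : a <= c by apply: amin; exists g => //; exact/laplacian2_eigenP.
rewrite energyE; apply: le_trans (cmin f); apply: ler_wpM2r => //.
by apply: wnorm2_ge0; exact: degw_gt0.
Qed.

Lemma energy_le_max_eigenvalue (a : R) :
  is_max (@laplacian2_eigenvalue V G R) a ->
  forall f, energy f <= a * wnorm2 degw f.
Proof.
move=> [[f0 f0_neq0 _] amax] f.
have [v0 _] := ffun_neq0 f0_neq0.
(* If [c] is the minimal quotient of the opposite form, then [- c] is an eigenvalue of the Laplacian
   and bounds the energy from above. *)
pose A i j := - lap_coef i j.
have Asym i j : A i j = A j i by rewrite /A lap_coef_sym.
have AE i (g : V -> R) : \sum_j A i j * g j = - \sum_j lap_coef i j * g j.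
  by rewrite -sumrN; apply: eq_bigr => j _; rewrite mulNr.
have [c [cmin [g g_neq0 gc]]] := rayleigh_min_eigen v0 Asym degw_gt0.
have ca : - c <= a.
  apply: amax; exists g => //; apply/laplacian2_eigenP => i.
  by apply: oppr_inj; rewrite -AE gc; ring.
have -> : energy f = - bilform A f f.
  rewrite energyE /bilform -sumrN; apply: eq_bigr => i _.
  by rewrite AE mulrN opprK.
apply: (@le_trans _ _ (- c * wnorm2 degw f)); first by rewrite mulNr lerN2.
apply: ler_wpM2r => //.
by apply: wnorm2_ge0; exact: degw_gt0.
Qed.

(** * Test functions of a family of vertex sets *)

Section Family.
Variables (k l : nat) (S : 'I_k -> {set V}).
Hypotheses (l_lt_k : (l < k)%N) (Skl : kl_family l S).
Let U := \bigcup_(r < k) S r.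

(** The constants are chosen so that the [k] functions sum to zero, each vertex of [U] lying in [l]
    of the sets. *)
Definition test_fun (r : 'I_k) : {ffun V -> R} :=
  [ffun i => k%:R * (i \in S r)%:R - l%:R * (i \in U)%:R].

Definition set_boundary (T : {set V}) h : R :=
  #|T :&: h.1|%:R - #|T :&: h.2|%:R.

Lemma set_boundaryE T h :
  set_boundary T h = \sum_i incidence h i * (i \in T)%:R.
Proof.
have cardE (X : {set V}) :
    #|T :&: X|%:R = \sum_i (i \in X)%:R * (i \in T)%:R :> R.
  rewrite -sum1_card natr_sum big_mkcond; apply: eq_bigr => i _.
  by rewrite inE andbC -natrM mulnb; case: (_ && _).
rewrite /set_boundary !cardE -sumrB.
by apply: eq_bigr => i _; rewrite /incidence; ring.
Qed.

Lemma sum_mem i : \sum_(r < k) (i \in S r)%:R = l%:R * (i \in U)%:R :> R.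
Proof.
have [iU|iNU] := boolP (i \in U); last first.
  rewrite mulr0 big1 // => r _; case: (boolP (i \in S r)) => // iS.
  by case/negP: iNU; apply/bigcupP; exists r.
rewrite mulr1 -(Skl iU) -sum1_card natr_sum [RHS]big_mkcond.
by apply: eq_bigr => r _; rewrite inE; case: ifP.
Qed.

(** A variance identity: the cross terms give [- 2 k l^2 u^2] and the constant terms [k l^2 u^2]. It
    serves once per hyperedge, for the energies, and once per vertex, for the norms. *)
Lemma sum_sqr_sub (a : 'I_k -> R) u : \sum_r a r = l%:R * u ->
  \sum_r (k%:R * a r - l%:R * u) ^+ 2 =
  k%:R * (k%:R * \sum_r a r ^+ 2 - l%:R ^+ 2 * u ^+ 2).
Proof.
move=> sa.
rewrite (eq_bigr (fun r => k%:R ^+ 2 * a r ^+ 2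
  - (k%:R * l%:R * u *+ 2) * a r + l%:R ^+ 2 * u ^+ 2)); last by move=> r _; ring.
by rewrite big_split sumrB -!mulr_sumr sa sumr_const card_ord /= -mulr_natl; ring.
Qed.

Lemma energy_test_sum :
  \sum_r energy (test_fun r) =
  k%:R * (k%:R * (\sum_r e G R (S r)) - l%:R ^+ 2 * e G R U).
Proof.
rewrite /energy /e exchange_big /= [in RHS]exchange_big /=.
rewrite !mulr_sumr -sumrB mulr_sumr.
apply: eq_bigr => h _.
rewrite -/(set_boundary U h).
under [in RHS]eq_bigr do rewrite -/(set_boundary _ h).
(* For a fixed [h], take [a r] and [u] to be the boundaries of [S r] and [U]; by linearity they
   inherit the relation [sum_mem] between indicators. *)
rewrite -sum_sqr_sub.
  apply: eq_bigr => r _; congr (_ ^+ 2).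
  rewrite boundaryE !set_boundaryE !mulr_sumr -sumrB.
  by apply: eq_bigr => i _; rewrite ffunE; ring.
under eq_bigr do rewrite set_boundaryE.
rewrite exchange_big set_boundaryE mulr_sumr; apply: eq_bigr => i _ /=.
by rewrite -mulr_sumr sum_mem; ring.
Qed.

Lemma wnorm2_test_sum :
  \sum_r wnorm2 degw (test_fun r) =
  k%:R * ((k - l)%:R * l%:R * (vol G U)%:R).
Proof.
rewrite /wnorm2 exchange_big /= /vol natr_sum [in RHS]big_mkcond !mulr_sumr.
apply: eq_bigr => i _; rewrite -mulr_sumr.
under eq_bigr do rewrite ffunE.
rewrite sum_sqr_sub ?sum_mem //.
(* Indicators equal their squares, so [sum_mem] also evaluates the sum of squares. *)
under eq_bigr do rewrite -natrX expnS expn1 mulnb andbb.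
rewrite sum_mem natrB ?(ltnW l_lt_k) // /degw.
by case: (i \in U); rewrite /=; ring.
Qed.

End Family.

End Laplacian.

Theorem theorem7p11 (R : realType) (V : finType) (G : oriented_hypergraph V)
    (deg_gt0 : forall i : V, (0 < deg G i)%N)
    (lambda1 lambdan : R)
    (lambda1_min : is_min (@laplacian2_eigenvalue V G R) lambda1)
    (lambdan_max : is_max (@laplacian2_eigenvalue V G R) lambdan) :
  [/\ is_min (@RQ2_value V G R) lambda1,
      is_max (@RQ2_value V G R) lambdan &
      forall (k l : nat) (S : 'I_k -> {set V}),
        (1 <= l)%N -> (l < k)%N ->
        kl_family l S ->
        \bigcup_(r < k) S r != finset.set0 ->
        let U := \bigcup_(r < k) S r in
        let q := (k%:R * (\sum_(r < k) e G R (S r)) - l%:R ^+ 2 * e G R U)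
                 / ((k - l)%:R * l%:R * (vol G U)%:R) in
        lambda1 <= q /\ q <= lambdan].
Proof.
have lo := min_eigenvalue_le_energy deg_gt0 lambda1_min.
have hi := energy_le_max_eigenvalue deg_gt0 lambdan_max.
have w_gt0 := @degw_gt0 R V G deg_gt0.
split.
- split; first by apply: laplacian2_eigenvalue_RQ2_value => //; case: lambda1_min.
  by move=> _ [f f_neq0 <-]; rewrite RQ2E ler_pdivlMr ?wnorm2_gt0.
- split; first by apply: laplacian2_eigenvalue_RQ2_value => //; case: lambdan_max.
  by move=> _ [f f_neq0 <-]; rewrite RQ2E ler_pdivrMr ?wnorm2_gt0.
move=> k l S l_gt0 l_lt_k Skl U_neq0 U q.
have k_gt0 : 0 < k%:R :> R by rewrite ltr0n (leq_trans _ l_lt_k).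
have vol_gt0 : (0 < vol G U)%N.
  have /finset.set0Pn [i iU] := U_neq0.
  by rewrite /vol (bigD1 i) //= ltn_addr.
have den_gt0 : 0 < (k - l)%:R * l%:R * (vol G U)%:R :> R.
  by rewrite -!natrM ltr0n !muln_gt0 subn_gt0 l_lt_k l_gt0.
rewrite /q ler_pdivlMr // ler_pdivrMr //.
(* Multiplying by [k] turns both sides into sums over the test functions, which are compared term by
   term. *)
split; rewrite -(ler_pM2l k_gt0) -(energy_test_sum R G Skl) mulrCA;
  rewrite -(wnorm2_test_sum R G l_lt_k Skl) mulr_sumr; apply: ler_sum => r _.
- exact: lo.
- exact: hi.
Qed.
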